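(* Let $f(x)=\sum_{i=0}^{n}a_ix^i=a_n(x-r_1)\cdots(x-r_n)$ be a polynomial of degree $n$ with complex coefficients ($a_n\neq0$). For an integer $k$ with $0\le k\le n$, let $$f^{(k)}(x)=\sum_{j=k}^{n}\frac{j!}{(j-k)!}a_jx^{j-k}=\frac{n!}{(n-k)!}\,a_n\,(x-r_{(k);1})\cdots(x-r_{(k);n-k})$$ be its derivative of order $k$, with complex roots $r_{(k);1},\ldots,r_{(k);n-k}$ listed with multiplicity. Then for every integer $m$ with $0\le m\le n-k$, $$\frac{(n-m)!}{n!}\sum_{\substack{(y_1,\ldots,y_m)\\ \sum i y_i=m}}\prod_{i=1}^{m}\frac{(-1)^{y_i}}{y_i!}\left(\frac1i\sum_{N=1}^{n}(r_N)^i\right)^{y_i}=\frac{(n-m-k)!}{(n-k)!}\sum_{\substack{(y_1,\ldots,y_m)\\ \sum i y_i=m}}\prod_{i=1}^{m}\frac{(-1)^{y_i}}{y_i!}\left(\frac1i\sum_{N=1}^{n-k}(r_{(k);N})^i\right)^{y_i},$$ where both sums run over all partitions of $m$.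
   Context: A partition of $m$ is represented by the tuple $(y_1,\ldots,y_m)$ of non-negative integers with $\sum_{i=1}^m i\,y_i=m$. For $m=0$ there is exactly one partition, the empty one. Empty products equal $1$, empty sums equal $0$, and $0^0=1$. *)

(* Defs.v *)
From mathcomp Require Import all_boot all_order all_algebra.
From mathcomp Require Import reals complex.

Set Implicit Arguments.
Unset Strict Implicit.
Unset Printing Implicit Defensive.

Import GRing.Theory.
Local Open Scope ring_scope.

(* A partition of m, with y i the multiplicity of the part i.+1.  Bounding the
   multiplicities by m makes the type finite and loses no partition, see
   [partition_mult_le]. *)
Definition partitions (m : nat) : {set {ffun 'I_m -> 'I_m.+1}} :=
  [set y : {ffun 'I_m -> 'I_m.+1} | \sum_(i < m) i.+1 * y i == m]%N.

Lemma partition_mult_le (m : nat) (y : 'I_m -> nat) (i : 'I_m) :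
  (\sum_(j < m) j.+1 * y j = m -> y i <= m)%N.
Proof.
move=> ym; rewrite -[X in (_ <= X)%N]ym (bigD1 i) //=.
exact: leq_trans (leq_pmull _ _) (leq_addr _ _).
Qed.

Definition partition_sum (F : fieldType) (d : nat) (r : 'I_d -> F) (m : nat)
    : F :=
  \sum_(y in partitions m) \prod_(i < m)
    ((-1) ^+ y i / (y i)`!%:R * (i.+1%:R^-1 * \sum_(N < d) r N ^+ i.+1) ^+ y i).

(* Main.v *)
Require Import Defs.
From mathcomp Require Import all_boot all_order all_algebra.
From mathcomp Require Import reals complex.
From mathcomp Require Import ring zify.

Import GRing.Theory.
Local Open Scope ring_scope.

(** Both sides equal [(n - m)`! / n`! * f`_(n - m) / a n].  Indeed, for
    [p = \prod_(N < d) ('X - r_N)] and [m <= d], the partition sum is the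
    coefficient of ['X^(d - m)] in [p]: this is the expression of elementary
    symmetric functions in power sums, i.e. the expansion of
    [\prod_N (1 - r_N X) = exp (- \sum_(i >= 1) p_i X^i / i)]
    where [p_i] is the [i]-th power sum of the [r_N].  Applied to [f] and to its
    [k]-th derivative, whose coefficients are those of [f] times falling
    factorials, it gives the theorem.

    The exponential identity is proved without power series.  Truncating
    each [exp (z_i X^i)], where [z_i = - p_i / i], gives polynomials whose
    product has the partition sum as coefficient at ['X^m]
    ([coef_prod_exp_poly]).  This product and [\prod_N (1 - r_N X)] have the
    same constant term and, modulo ['X^m], the same logarithmic derivative; in
    characteristic 0 they then agree up to degree [m]
    ([coef_eq_of_log_deriv]). *)

(** * Logarithmic derivatives modulo a power of the variable *)

Section PowerSums.
Set Implicit Arguments.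
Unset Strict Implicit.

Variable F : fieldType.
Implicit Types g h l : {poly F}.

(** Multiplying [g' / g = l] by [g] keeps the relation among polynomials; no
    inverse of [g] modulo ['X^M] has to be formed. *)
Definition log_deriv M g l := 'X^M %| g^`() - l * g.

Lemma log_deriv_prod (M d : nat) (g l : 'I_d -> {poly F}) :
  (forall i, log_deriv M (g i) (l i)) ->
  log_deriv M (\prod_i g i) (\sum_i l i).
Proof.
move=> gl; apply: (big_rec2 (log_deriv M)) => [|i l' g' _ IH].
  by rewrite /log_deriv derivC mul0r subr0 dvdp0.
rewrite /log_deriv derivM.
have -> : (g i)^`() * l' + g i * l'^`() - (l i + g') * (g i * l') =
          ((g i)^`() - l i * g i) * l' + g i * (l'^`() - g' * l') by ring.
by apply: dvdp_add; [apply/dvdp_mulr/gl | apply: dvdp_mull].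
Qed.

Lemma coef_dvdXn (M j : nat) g : 'X^M %| g -> (j < M)%N -> g`_j = 0.
Proof. by case/dvdpP=> q -> jM; rewrite coefMXn jM. Qed.

(** Comparing coefficients at ['X^j] in [g' = l * g] determines [g`_j.+1] from
    the lower coefficients, as soon as [j.+1] is invertible. *)
Lemma coef_eq_of_log_deriv (M j : nat) g h l :
    [pchar F] =i pred0 -> log_deriv M g l -> log_deriv M h l ->
  g`_0 = h`_0 -> (j <= M)%N -> g`_j = h`_j.
Proof.
move=> F0 gl hl gh0; elim/ltn_ind: j => -[//|j] IH jM.
have dgh : 'X^M %| (g - h)^`() - l * (g - h).
  have -> : (g - h)^`() - l * (g - h) = (g^`() - l * g) - (h^`() - l * h).
    by rewrite derivB; ring.
  exact: dvdp_sub.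
move: (coef_dvdXn dgh jM); rewrite coefB coef_deriv coefM big1 ?subr0.
  move/eqP; rewrite -mulr_natr mulf_eq0 ((pcharf0P F).1 F0) orbF coefB subr_eq0.
  by move/eqP.
move=> i _; rewrite coefB IH ?subrr ?mulr0 ?ltnS ?leq_subr //.
exact: leq_trans (leq_subr _ _) (ltnW jM).
Qed.

(** * Products of truncated exponentials *)

(** The series [exp (z * 'X^i.+1)] cut off after the power [M] of its argument. *)
Definition exp_poly (M i : nat) (z : F) : {poly F} :=
  \sum_(j < M.+1) (z ^+ j / j`!%:R) *: 'X^(i.+1 * j).

(** Grouping the terms of the expanded product by degree: a choice of one
    monomial in each factor contributes to ['X^m] exactly when it is a
    partition of [m]. *)
Lemma coef_prod_exp_poly (m : nat) (z : 'I_m -> F) :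
  (\prod_(i < m) exp_poly m i (z i))`_m =
  \sum_(y in partitions m) \prod_(i < m) (z i ^+ y i / (y i)`!%:R).
Proof.
rewrite bigA_distr_bigA coef_sum /= [RHS]big_mkcond; apply: eq_bigr => y _.
rewrite inE scaler_prod prodrXr coefZ coefXn eq_sym.
by case: eqP; rewrite ?mulr1 ?mulr0.
Qed.

Lemma coef0_exp_poly (M i : nat) (z : F) : (exp_poly M i z)`_0 = 1.
Proof.
rewrite coef_sum big_ord_recl big1 => [|j _].
  by rewrite coefZ muln0 coefXn mulr1 addr0 fact0 divr1.
by rewrite coefZ coefXn mulr0.
Qed.

(** [(exp (z X^i.+1))' = i.+1 z X^i exp (z X^i.+1)]; the truncation only affects
    degrees at least [M]. *)
Lemma log_deriv_exp_poly (M i : nat) (z : F) : [pchar F] =i pred0 ->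
  log_deriv M (exp_poly M i z) ((i.+1%:R * z) *: 'X^i).
Proof.
move=> F0; rewrite /log_deriv /exp_poly.
(* Term [j.+1] of [g'] cancels term [j] of [l * g]; the last term of [l * g]
   is left over, and it is a multiple of ['X^M]. *)
rewrite [X in _ - _ * X]big_ord_recr big_ord_recl /= mulrDr opprD addrA.
rewrite derivD raddf_sum /= derivZ muln0 derivC scaler0 add0r.
rewrite mulr_sumr -sumrB big1 => [|j _].
  by rewrite add0r dvdpNr -scalerAr -mul_polyC !dvdp_mull // dvdp_exp2l ?leq_pmull.
rewrite derivZ derivXn -scalerAl -scalerAr -exprD scalerA mulnS /=.
rewrite -scaler_nat !scalerA -scalerBl.
rewrite [X in X *: _](_ : _ = 0) ?scale0r //.
have j0 : j.+1%:R != 0 :> F by rewrite ((pcharf0P F).1 F0).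
have f0 : j`!%:R != 0 :> F by rewrite ((pcharf0P F).1 F0) -lt0n fact_gt0.
rewrite -mulnS factS exprS !natrM.
field.
by rewrite f0 addrC natr1 j0.
Qed.

(** The telescoping [(1 - c X) * \sum_(i < M) (c X)^i = 1 - (c X)^M]. *)
Lemma log_deriv_linear (M : nat) (c : F) :
  log_deriv M (1 - c *: 'X) (- \sum_(i < M) c ^+ i.+1 *: 'X^i).
Proof.
have -> : \sum_(i < M) c ^+ i.+1 *: 'X^i = c%:P * \sum_(i < M) (c *: 'X) ^+ i.
  rewrite mulr_sumr; apply: eq_bigr => i _.
  by rewrite exprZn mul_polyC scalerA -exprS.
set S := \sum_(i < M) _.
have tel : (1 - c *: 'X) * S = 1 - (c *: 'X) ^+ M.
  by rewrite -opprB mulNr -subrX1 opprB.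
rewrite /log_deriv.
have -> : (1 - c *: 'X)^`() - - (c%:P * S) * (1 - c *: 'X) =
          - c%:P * (c *: 'X) ^+ M.
  rewrite derivB derivZ derivX derivC alg_polyC.
  by rewrite mulNr opprK -mulrA [S * _]mulrC tel; ring.
by rewrite exprZn -scalerAr -mul_polyC !dvdp_mull.
Qed.

(** * Partition sums as coefficients *)

(** The identity [\prod_N (1 - r_N X) = exp (- \sum_(i >= 1) p_i X^i / i)], read at
    degree [m]; the parts [i > m] of the exponent cannot contribute there. *)
Lemma coef_prod_1subZX (d : nat) (r : 'I_d -> F) (m : nat) :
  [pchar F] =i pred0 ->
  (\prod_(N < d) (1 - r N *: 'X))`_m = partition_sum r m.
Proof.
move=> F0; pose z (i : 'I_m) := - (i.+1%:R^-1 * \sum_(N < d) r N ^+ i.+1).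
have -> : partition_sum r m = (\prod_(i < m) exp_poly m i (z i))`_m.
  rewrite coef_prod_exp_poly; apply: eq_bigr => y _; apply: eq_bigr => i _.
  by rewrite [z i ^+ _]exprNn mulrAC.
have log_z : \sum_(i < m) (i.+1%:R * z i) *: 'X^i =
             \sum_(N < d) - \sum_(i < m) r N ^+ i.+1 *: 'X^i :> {poly F}.
  rewrite sumrN exchange_big -sumrN; apply: eq_bigr => i _ /=.
  rewrite mulrN mulrA divff ?((pcharf0P F).1 F0) // mul1r.
  by rewrite scaleNr scaler_suml.
apply: coef_eq_of_log_deriv (leqnn m) => //.
- by apply: log_deriv_prod => N; apply: log_deriv_linear.
- by rewrite -log_z; apply: log_deriv_prod => i; apply: log_deriv_exp_poly.
rewrite -!horner_coef0 !horner_prod !big1 // => i _.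
  by rewrite horner_coef0 coef0_exp_poly.
by rewrite hornerD hornerN hornerZ hornerX hornerC mulr0 subr0.
Qed.

(** [\prod_N (1 - r_N X)] is the reciprocal polynomial of [\prod_N (X - r_N)]: a
    set [J] of factors contributing their first term gives ['X^#|J|] in one
    product and ['X^(d - #|J|)] in the other, with the same coefficient. *)
Lemma coef_prod_XsubC_rev (d : nat) (r : 'I_d -> F) (m : nat) : (m <= d)%N ->
  (\prod_(N < d) ('X - (r N)%:P))`_(d - m) = (\prod_(N < d) (1 - r N *: 'X))`_m.
Proof.
move=> md; rewrite !bigA_distr !coef_sum; apply: eq_bigr => J _.
have cardJC : #|~: J| = (d - #|J|)%N by rewrite cardsCs setCK card_ord.
have leJ : (#|J| <= d)%N by rewrite -[X in (_ <= X)%N]card_ord max_card.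
rewrite !big_if /= big1_eq mul1r prodr_const mulrC.
under eq_bigr do rewrite -polyCN.
under [in RHS]eq_bigr do rewrite -scaleNr.
rewrite -rmorph_prod coefCM coefXn scaler_prod coefZ prodr_const coefXn.
congr (_ * _%:R).
have -> : #|[pred i | i \notin J]| = (d - #|J|)%N.
  by rewrite -cardJC; apply: eq_card => i; rewrite !inE.
congr nat_of_bool; apply/eqP/eqP; lia.
Qed.

End PowerSums.

Theorem theorem4p2 (R : realType) (n : nat) (a : nat -> R[i]) (f : {poly R[i]})
    (r : 'I_n -> R[i]) (k : nat) (rk : 'I_(n - k) -> R[i]) (m : nat)
    (han : a n != 0)
    (hf : f = \poly_(i < n.+1) a i)
    (hr : f = a n *: \prod_(N < n) ('X - (r N)%:P))
    (hk : (k <= n)%N)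
    (hrk : f^`(k) = (n`!%:R / (n - k)`!%:R * a n) *:
                    \prod_(N < n - k) ('X - (rk N)%:P))
    (hm : (m <= n - k)%N) :
  (n - m)`!%:R / n`!%:R * partition_sum r m =
  (n - m - k)`!%:R / (n - k)`!%:R * partition_sum rk m.
Proof.
have C0 : [pchar R[i]] =i pred0 by exact: Num.Theory.pchar_num.
have fact_neq0 j : j`!%:R != 0 :> R[i].
  by rewrite ((pcharf0P R[i]).1 C0) -lt0n fact_gt0.
have mn : (m <= n)%N by apply: leq_trans hm (leq_subr _ _).
have nkm : (k + (n - k - m) = n - m)%N by lia.
move: (congr1 (fun p : {poly R[i]} => p`_(n - k - m)) hrk).
rewrite /= coef_derivn nkm hr !coefZ !coef_prod_XsubC_rev // !coef_prod_1subZX //.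
rewrite -[_ *+ (_ ^_ _)]mulr_natr => /(congr1 (fun x => x * (n - k - m)`!%:R)).
have -> : (n - m - k = n - k - m)%N by lia.
have ffE : ((n - m) ^_ k)%:R * (n - k - m)`!%:R = (n - m)`!%:R :> R[i].
  rewrite -natrM -(@ffact_fact (n - m) k); last by lia.
  by congr (_ * _`!)%:R; lia.
move=> E; apply: (mulfI han); apply: (mulfI (fact_neq0 n)).
(* [E] compares the coefficients of [f^`(k)] at ['X^(n - k - m)]. *)
transitivity (a n * partition_sum r m * ((n - m) ^_ k)%:R * (n - k - m)`!%:R).
  by rewrite -[RHS]mulrA ffE; field; rewrite fact_neq0.
by rewrite E; field; rewrite !fact_neq0.
Qed.
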